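(* For every $f\in\mathcal{A}$ with $J(f)>0$, it holds $\mathrm{Ent}(f)\in(-\infty,+\infty)$ and $$\delta J(f,f)=nJ(f)+\int_{\mathbb{R}^n}f\log f\,dx=\big(n+\log J(f)\big)J(f)+\mathrm{Ent}(f).$$
   Context: Fix $n\ge 1$. For a convex function $u:\mathbb{R}^n\to\mathbb{R}\cup\{+\infty\}$, $\mathrm{dom}(u)=\{x: u(x)\in\mathbb{R}\}$ and $u$ is proper if $\mathrm{dom}(u)\ne\emptyset$. $\mathcal{L}$ is the set of proper convex $u:\mathbb{R}^n\to\mathbb{R}\cup\{+\infty\}$ with $\lim_{\|x\|\to+\infty}u(x)=+\infty$, and $\mathcal{A}=\{e^{-u}: u\in\mathcal{L}\}$ (with $e^{-\infty}=0$). Operations: $u\Box v(x)=\inf_{y\in\mathbb{R}^n}\{u(x-y)+v(y)\}$; $(u\alpha)(x)=\alpha u(x/\alpha)$ for $\alpha>0$, and $u0=I_{\{0\}}$ (equal to $0$ at the origin and $+\infty$ elsewhere). For $f=e^{-u}$, $g=e^{-v}$ in $\mathcal{A}$ and $t\ge0$, $f\oplus t\cdot g=e^{-[u\Box(vt)]}$. $J(f)=\int_{\mathbb{R}^n}f\,dx\in[0,+\infty)$ and $\delta J(f,g)=\lim_{t\to0^+}\frac{J(f\oplus t\cdot g)-J(f)}{t}$. The entropy is $\mathrm{Ent}(f)=\int_{\mathbb{R}^n}f\log f\,dx-J(f)\log J(f)$ (with $0\log0=0$). *)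

(* Defs.v *)
From HB Require Import structures.
From mathcomp Require Import all_boot all_order all_algebra.
From mathcomp Require Import all_classical all_reals all_analysis.

Set Implicit Arguments.
Unset Strict Implicit.
Unset Printing Implicit Defensive.

Import Order.TTheory GRing.Theory Num.Theory.
Import numFieldNormedType.Exports.

Local Open Scope classical_set_scope.
Local Open Scope ring_scope.

(* Lebesgue measure on R^n, n >= 1, written 'rV[R]_n.+1: the Caratheodory
   restriction of the outer measure given by countable covers by closed boxes.
   The sigma-algebra is thus that of all Lebesgue measurable sets; Borel sets
   would not suffice, since for n >= 2 a convex set need not be Borel. *)
Section lebesgue_rV.
Context (R : realType) (n : nat).
Implicit Types (a b x : 'rV[R]_n.+1) (X : set 'rV[R]_n.+1).

Definition box a b : set 'rV[R]_n.+1 :=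
  [set x | forall i, a 0 i <= x 0 i <= b 0 i].

Definition box_volume a b : R := \prod_(i < n.+1) (b 0 i - a 0 i).

Definition box_cover X :=
  [set B : nat -> 'rV[R]_n.+1 * 'rV[R]_n.+1 |
           (forall k i, (B k).1 0 i <= (B k).2 0 i) /\
           X `<=` \bigcup_k box (B k).1 (B k).2].

Definition lebesgue_outer X : \bar R :=
  ereal_inf [set (\sum_(0 <= k <oo) (box_volume (B k).1 (B k).2)%:E)%E
            | B in box_cover X].

Local Lemma box_cover_volume_ge0 X B k :
  box_cover X B -> (0 <= (box_volume (B k).1 (B k).2)%:E)%E.
Proof.
move=> [B12 _]; rewrite lee_fin; apply: prodr_ge0 => i _.
by rewrite subr_ge0; exact: B12.
Qed.

Local Lemma lebesgue_outer_ge0 X : (0 <= lebesgue_outer X)%E.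
Proof.
apply: le_ereal_inf_tmp => _ [B XB <-].
by apply: nneseries_ge0 => k _ _; exact: box_cover_volume_ge0 XB.
Qed.

Local Lemma lebesgue_outer0 : lebesgue_outer set0 = 0%E.
Proof.
apply/eqP; rewrite eq_le lebesgue_outer_ge0 andbT.
apply: ereal_inf_lbound; exists (fun=> (0, 0)); first by split.
apply: eseries0 => k _ _ /=.
by rewrite /box_volume big_ord_recl !mxE subrr mul0r.
Qed.

Local Lemma le_lebesgue_outer :
  {homo lebesgue_outer : A B / A `<=` B >-> (A <= B)%E}.
Proof.
move=> A B AB; apply: ereal_inf_le_tmp => _ [C [C12 BC] <-].
by exists C => //; split => //; exact: subset_trans BC.
Qed.

Local Lemma lebesgue_outer_sigma_subadditive :
  sigma_subadditive lebesgue_outer.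
Proof.
Local Open Scope ereal_scope.
move=> A; have [[i ioo]|] := pselect (exists i, lebesgue_outer (A i) = +oo).
  rewrite (eseries_pinfty _ _ ioo) ?leey// => k _.
  by rewrite -ltNye (lt_le_trans _ (lebesgue_outer_ge0 _)).
rewrite -forallNE => Aoo.
suff add2e (e : {posnum R}) : lebesgue_outer (\bigcup_k A k) <=
    \sum_(i <oo) lebesgue_outer (A i) + e%:num%:E.
  by apply/lee_addgt0Pr => _/posnumP[].
rewrite (le_trans _ (epsilon_trick _ _ _))//; last first.
  by move=> k; exact: lebesgue_outer_ge0.
pose vol (c : 'rV[R]_n.+1 * 'rV[R]_n.+1) := (box_volume c.1 c.2)%:E.
pose P k B := box_cover (A k) B /\
  \sum_(j <oo) vol (B j) <= lebesgue_outer (A k) + (e%:num / (2 ^ k.+1)%:R)%:E.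
have [G PG] : {G & forall k, P k (G k)}.
  apply: (@choice _ _ P) => k; rewrite /P.
  have Ak : lebesgue_outer (A k) \is a fin_num.
    by rewrite ge0_fin_numE ?lebesgue_outer_ge0// ltey; exact/eqP.
  have en1 : (0 < e%:num / (2 ^ k.+1)%:R :> R)%R by [].
  have [_ [B AB <-] xS] := lb_ereal_inf_adherent en1 Ak.
  by exists B; split => //; exact/ltW.
have vG_ge0 p : 0 <= (vol \o uncurry G) p.
  by case: p => i j; exact: (box_cover_volume_ge0 _ (PG i).1).
apply: (@le_trans _ _ (\esum_(i in setT) (vol \o uncurry G) i)).
  apply: ereal_inf_lbound => /=.
  have /card_esym/ppcard_eqP[f] := card_nat2.
  exists (uncurry G \o f).
    split => [k i|].
      by rewrite /= /uncurry; case: (f k) => p q; exact: ((PG p).1.1 q i).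
    move=> t [i _ Ait]; have [j _ ?] := (PG i).1.2 _ Ait.
    exists (f^-1%FUN (i, j)) => //=.
    by rewrite invK ?inE.
  rewrite -(esum_pred_image (vol \o uncurry G) _ xpredT) ?[fun=> _]set_true//.
  by rewrite image_eq.
rewrite (_ : esum _ _ = \sum_(i <oo) \sum_(j <oo ) vol (G i j)); last first.
  pose J : nat -> set (nat * nat) := fun i => [set (i, j) | j in setT].
  rewrite (_ : setT = \bigcup_k J k); last first.
    by rewrite predeqE => -[a b]; split => // _; exists a => //; exists b.
  rewrite esum_bigcupT /=; last 2 first.
    - apply/trivIsetP => i j _ _ ij.
      rewrite predeqE => -[p m] /=; split => //= -[] [_] _ [<-{p} _].
      by move=> [m' _] [] /esym/eqP; rewrite (negbTE ij).
    - by move=> [i j]; exact: (vG_ge0 (i, j)).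
  rewrite -(image_id [set: nat]) -fun_true esum_pred_image//; last first.
    by move=> k _; apply: esum_ge0 => -[i j] _; exact: (vG_ge0 (i, j)).
  apply: eq_eseriesr => /= j _.
  rewrite -(esum_pred_image (vol \o uncurry G) (pair j) predT)//=; first last.
  - by move=> ? ? _ _; exact: (@can_inj _ _ _ snd).
  - by move=> k _; exact: (vG_ge0 (j, k)).
  by congr esum; rewrite predeqE => -[a b]; split; move=> [i _ <-]; exists i.
apply: lee_lim.
- apply: is_cvg_nneseries => k *.
  by apply: nneseries_ge0 => m *; exact: (vG_ge0 (k, m)).
- apply: is_cvg_nneseries => k *; apply: adde_ge0 => //.
  exact: lebesgue_outer_ge0.
- by near=> k; apply: lee_sum => i _; exact: (PG i).2.
Unshelve. all: by end_near. Qed.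

HB.instance Definition _ := isOuterMeasure.Build R 'rV[R]_n.+1 lebesgue_outer
  lebesgue_outer0 lebesgue_outer_ge0 le_lebesgue_outer
  lebesgue_outer_sigma_subadditive.

Definition lebesgue_rV : set (caratheodory_type lebesgue_outer) -> \bar R :=
  lebesgue_outer.

HB.instance Definition _ := isMeasure.Build _ _ _ lebesgue_rV
  (@caratheodory_measure0 _ _ lebesgue_outer)
  (@caratheodory_measure_ge0 _ _ lebesgue_outer)
  (@caratheodory_measure_sigma_additive _ _ lebesgue_outer).

End lebesgue_rV.
Arguments lebesgue_rV {R n}.

Section functions.
Context (R : realType) (n : nat).
Implicit Types (u v f g : 'rV[R]_n.+1 -> \bar R) (t : R).
Local Open Scope ereal_scope.

Definition euclidean_norm (x : 'rV[R]_n.+1) : R :=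
  Num.sqrt (\sum_i x 0%R i ^+ 2)%R.

Definition edom u : set 'rV[R]_n.+1 := [set x | u x \is a fin_num].

(* With the library convention 0 * +oo = 0, the endpoints s = 0, 1 are
   harmless. *)
Definition econvex u := forall (x y : 'rV[R]_n.+1) (s : R),
  (0 <= s <= 1)%R ->
  u (s *: x + (1 - s) *: y)%R <= s%:E * u x + (1 - s)%:E * u y.

Definition coercive u := forall M : R, exists r : R,
  forall x, (r < euclidean_norm x)%R -> M%:E < u x.

Definition classL : set ('rV[R]_n.+1 -> \bar R) :=
  [set u | [/\ forall x, u x != -oo, edom u !=set0, econvex u & coercive u]].

Definition classA : set ('rV[R]_n.+1 -> \bar R) :=
  [set f | exists2 u, classL u & f = fun x => expeR (- u x)].

Definition infconv u v : 'rV[R]_n.+1 -> \bar R :=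
  fun x => ereal_inf (range (fun y => u (x - y)%R + v y)).

(* Only used for t >= 0. *)
Definition rscale u t : 'rV[R]_n.+1 -> \bar R := fun x =>
  if t == 0%R then (if x == 0%R then 0 else +oo)
  else t%:E * u (t^-1 *: x)%R.

(* The u such that f = exp (- u), as lne 0 = -oo. *)
Definition potential f : 'rV[R]_n.+1 -> \bar R := fun x => - lne (f x).

Definition oplus f t g : 'rV[R]_n.+1 -> \bar R := fun x =>
  expeR (- infconv (potential f) (rscale (potential g) t) x).

Definition J f : \bar R := \int[lebesgue_rV]_x f x.

Definition deltaJ_quotient f g t : \bar R :=
  (J (oplus f t g) - J f) * t^-1%:E.

Definition deltaJ f g : \bar R :=
  lim (deltaJ_quotient f g t @[t --> 0%R^'+]).

(* 0 * lne 0 = 0 * -oo = 0 *)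
Definition int_flogf f : \bar R := \int[lebesgue_rV]_x (f x * lne (f x)).

Definition entropy f : \bar R := int_flogf f - J f * lne (J f).

End functions.

(* Main.v *)
Require Import Defs.
From mathcomp Require Import all_boot all_order all_algebra.
From mathcomp Require Import all_classical all_reals all_analysis.
From mathcomp Require Import ring lra measurable_realfun lebesgue_integral_under.
Import Order.TTheory GRing.Theory Num.Theory.
Import numFieldNormedType.Exports.
Local Open Scope classical_set_scope.
Local Open Scope ereal_scope.

(** Write f = exp (- u), and let N = n.+1 be the dimension. Convexity of u turns
the inf-convolution of u with its own dilation into a single dilation,
u [] (u t) (x) = (1 + t) u (x / (1 + t)), the infimum being reached at
y = t x / (1 + t) (lemma infconv_rscale). A homothety then gives
J (f (+) t . f) = (1 + t)^N * (integral of exp (- (1 + t) u)), and the formula is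
the product rule at t = 0: the first factor contributes N J f, and
differentiating under the integral contributes the integral of
- u exp (- u) = f log f. What remains is to justify this computation.

Integrability. Since J f > 0, the domain of u is not Lebesgue null. Hyperplanes
are null, so the domain contains the vertices of a nondegenerate simplex, and u
is bounded above on a ball. Together with coercivity and convexity this yields
u x >= a |x| - c with a > 0 (lemma classL_linear_growth), so that every
exp (- s u) with s > 0 is integrable. The t-derivative of exp (- (1 + t) u) is
dominated, for |t| < 1/4, by a multiple of exp (- u / 2), because |u| is
absorbed by the remaining exponential decay.

Measurability. As u is not assumed to be lower semicontinuous, its sublevel sets
are arbitrary convex sets, which need not be Borel. They are Lebesgue
measurable: a convex set is either null or contains a ball around some point b,
and in the second case shrinking its closure towards b lands in its interior,
which forces the boundary to be null when the set is bounded (lemma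
measurable_convex). *)

Section variation.
Local Open Scope ring_scope.
Context {R : realType} {n : nat}.
Local Notation V := 'rV[R]_n.+1.
(* the same carrier, with the sigma-algebra of Lebesgue measurable sets *)
Local Notation Vm := (caratheodory_type (@lebesgue_outer R n)).
Local Notation lam := (@lebesgue_outer R n).
Local Notation mu := (@lebesgue_rV R n).
Implicit Types (a b p x y : V) (X Y : set V) (c r s t : R) (u : V -> \bar R).

(** * Homotheties, boxes and open sets *)

Definition homothety p c x : V := p + c *: x.

Lemma homothetyK p c : c != 0 ->
  cancel (homothety p c) (homothety (- (c^-1 *: p)) c^-1).
Proof.
by move=> c0 x; rewrite /homothety scalerDr scalerA mulVf// scale1r addKr.
Qed.

Lemma homothetyVK p c : c != 0 ->
  cancel (homothety (- (c^-1 *: p)) c^-1) (homothety p c).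
Proof.
move=> c0 x; rewrite /homothety scalerDr scalerN !scalerA mulfV// !scale1r.
by rewrite addrA subrr add0r.
Qed.

Lemma box_volume_ge0 a b : (forall i, a 0 i <= b 0 i) -> 0 <= box_volume a b.
Proof. by move=> ab; apply: prodr_ge0 => i _; rewrite subr_ge0. Qed.

Lemma box_volume_homothety p c a b :
  box_volume (homothety p c a) (homothety p c b) = c ^+ n.+1 * box_volume a b.
Proof.
rewrite /box_volume -[in c ^+ _](card_ord n.+1) -prodr_const -big_split/=.
by apply: eq_bigr => i _; rewrite !mxE; ring.
Qed.

Lemma lebesgue_outer_homothety_le p c X : 0 < c ->
  (lebesgue_outer (homothety p c @` X) <= (c ^+ n.+1)%:E * lebesgue_outer X)%E.
Proof.
move=> c0; rewrite -lee_pdivrMl ?exprn_gt0//.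
apply: le_ereal_inf_tmp => _ [B [B12 XB] <-].
rewrite lee_pdivrMl ?exprn_gt0//.
rewrite -nneseriesZl//; last by move=> k _; rewrite lee_fin box_volume_ge0.
apply: ereal_inf_lbound.
exists (fun k => (homothety p c (B k).1, homothety p c (B k).2)).
  split=> [k i|_ [x Xx <-]]/=.
    by rewrite !mxE lerD2l ler_pM2l.
  have [k _ xB] := XB _ Xx; exists k => // i /=; have := xB i.
  by rewrite !mxE !lerD2l !(ler_pM2l c0).
by apply: eq_eseriesr => k _ /=; rewrite box_volume_homothety EFinM.
Qed.

Lemma lebesgue_outer_homothety p c X : 0 < c ->
  lebesgue_outer (homothety p c @` X) = ((c ^+ n.+1)%:E * lebesgue_outer X)%E.
Proof.
move=> c0; apply/eqP; rewrite eq_le lebesgue_outer_homothety_le//=.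
rewrite -lee_pdivlMl ?exprn_gt0//.
have := @lebesgue_outer_homothety_le (- (c^-1 *: p)) c^-1
  (homothety p c @` X).
rewrite invr_gt0 exprVn => /(_ c0); congr (_ <= _)%E.
rewrite image_comp (_ : _ \o _ = id) ?image_id//.
by apply/funext => x; rewrite /= homothetyK// gt_eqF.
Qed.

Lemma preimage_homothety p c X : 0 < c ->
  homothety p c @^-1` X = homothety (- (c^-1 *: p)) c^-1 @` X.
Proof.
move=> c0; have c0' : c != 0 by rewrite gt_eqF.
apply/seteqP; split => [x Xx|_ [x Xx <-]].
  by exists (homothety p c x) => //; rewrite homothetyK.
by rewrite /= homothetyVK.
Qed.

Lemma lebesgue_outer_preimage_homothety p c X : 0 < c ->
  lebesgue_outer (homothety p c @^-1` X) =
  ((c ^- n.+1)%:E * lebesgue_outer X)%E.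
Proof.
move=> c0; rewrite preimage_homothety// lebesgue_outer_homothety ?invr_gt0//.
by rewrite exprVn.
Qed.

Lemma measurable_homothety p c : 0 < c ->
  measurable_fun [set: Vm] (homothety p c : Vm -> Vm).
Proof.
move=> c0 _ A mA; rewrite setTI.
have {}mA : lam.-caratheodory (A : set V) := mA.
suff hA : lam.-caratheodory (homothety p c @^-1` (A : set V)) by [].
have main Y : lam (homothety p c @^-1` Y) =
    (lam (homothety p c @^-1` (Y `&` A)) +
     lam (homothety p c @^-1` (Y `&` ~` A)))%E.
  by rewrite !lebesgue_outer_preimage_homothety// (mA Y) ge0_muleDr//
    outer_measure_ge0.
move=> X.
have cK : homothety p c @^-1` (homothety p c @` X) = X.
  apply/seteqP; split => [x [y Xy]|x Xx]; last by exists x.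
  by move=> /(can_inj (homothetyK p c (lt0r_neq0 c0))) <-.
by have := main (homothety p c @` X); rewrite !preimage_setI cK.
Qed.

Lemma lebesgue_outer_box_le a b : (forall i, a 0 i <= b 0 i) ->
  (lebesgue_outer (box a b) <= (box_volume a b)%:E)%E.
Proof.
move=> ab.
pose B (k : nat) : V * V := if k == 0%N then (a, b) else (0, 0).
apply: (@le_trans _ _ (\sum_(0 <= k <oo) (box_volume (B k).1 (B k).2)%:E)%E).
  apply: ereal_inf_lbound; exists B => //; split.
    by move=> k i; rewrite /B; case: ifP.
  by move=> x abx; exists 0%N.
rewrite (@nneseriesD1 _ _ 0%N)//; last first.
  by move=> k _; rewrite lee_fin box_volume_ge0// /B; case: ifP.
rewrite eseries0 ?adde0//= => k _ /negbTE k0.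
by rewrite /B k0 /box_volume big_ord_recl !mxE subrr mul0r.
Qed.

Definition set_coord x i r : V := \row_j (if j == i then r else x 0 j).

Lemma box_volume_split a b i r :
  box_volume a b = box_volume a (set_coord b i r) + box_volume (set_coord a i r) b.
Proof.
rewrite /box_volume (bigD1 i)//= [in RHS](bigD1 i)//=.
rewrite [X in _ = _ + X](bigD1 i)//= !mxE eqxx.
set P := \prod_(j < _ | j != i) _.
rewrite (_ : \prod_(j < _ | j != i) _ = P); last first.
  by apply: eq_bigr => j /negbTE ji; rewrite !mxE ji.
rewrite [X in _ + _ * X](_ : _ = P); last first.
  by apply: eq_bigr => j /negbTE ji; rewrite !mxE ji.
ring.
Qed.

(** Cutting every box of a cover of X along the hyperplane covers the two parts
of X separately, with the same total volume. *)
Lemma measurable_halfspace i r : measurable ([set x | x 0 i < r] : set Vm).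
Proof.
apply: le_caratheodory_measurable => X.
apply: le_ereal_inf_tmp => _ [B [B12 XB] <-].
(* The cut is clamped to the edge of the box, so that both halves are boxes
   with ordered endpoints, one of them degenerate if the hyperplane misses
   the box. *)
pose m k := Num.min ((B k).2 0 i) (Num.max ((B k).1 0 i) r).
have m1 k : (B k).1 0 i <= m k by rewrite /m le_min B12 le_max lexx.
have m2 k : m k <= (B k).2 0 i by rewrite /m ge_min lexx.
pose Bl k := ((B k).1, set_coord (B k).2 i (m k)).
pose Bu k := (set_coord (B k).1 i (m k), (B k).2).
have Bl12 k j : (Bl k).1 0 j <= (Bl k).2 0 j.
  by rewrite /= mxE; case: eqP => [->|_] //.
have Bu12 k j : (Bu k).1 0 j <= (Bu k).2 0 j.
  by rewrite /= mxE; case: eqP => [->|_] //.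
rewrite (_ : limn _ = (\sum_(0 <= k <oo) (box_volume (Bl k).1 (Bl k).2)%:E +
   \sum_(0 <= k <oo) (box_volume (Bu k).1 (Bu k).2)%:E)%E); last first.
  rewrite -nneseriesD.
  - by apply: eq_eseriesr => k _; rewrite -EFinD (box_volume_split _ _ i (m k)).
  - by move=> k _ _; rewrite lee_fin box_volume_ge0.
  - by move=> k _ _; rewrite lee_fin box_volume_ge0.
apply: leeD; apply: ereal_inf_lbound.
  exists Bl => //; split=> // x [/XB[k _ xB] /= xir]; exists k => // j.
  rewrite mxE; case: eqP => [->|_]; last exact: xB.
  have /andP[-> x2] := xB i; rewrite /m le_min x2/= le_max.
  by rewrite (ltW xir) orbT.
exists Bu => //; split=> // x [/XB[k _ xB] /= /negP]; rewrite -leNgt => xir.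
exists k => // j.
rewrite mxE; case: eqP => [->|_]; last exact: xB.
by have /andP[x1 ->] := xB i; rewrite /m ge_min ge_max x1 xir/= orbT.
Qed.

Lemma measurable_coord i : measurable_fun [set: Vm] (fun x : Vm => (x : V) 0 i).
Proof.
move=> mT; apply: (measurability _ (RGenInftyO.measurableE R)) => //.
move=> _ [_ [r ->] <-]; rewrite setTI.
rewrite [X in measurable X](_ : _ = [set x : V | x 0 i < r]).
  exact: measurable_halfspace.
by apply/seteqP; split => x /=; rewrite in_itv.
Qed.

Lemma measurable_box a b : measurable (box a b : set Vm).
Proof.
rewrite (_ : box a b = \bigcap_(i in [set: 'I_n.+1])
   ((fun x : Vm => (x : V) 0 i) @^-1` `[a 0 i, b 0 i])).
  apply: fin_bigcap_measurable => // i _.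
  by rewrite -[X in measurable X]setTI; apply: measurable_coord.
apply/seteqP; split => [x xab i _ /=|x xab i]; first by rewrite in_itv/=.
by have := xab i I; rewrite /= in_itv.
Qed.

Definition cube (r : R) : set V := box (const_mx (- r)) (const_mx r).

Lemma cubeE (r : R) x : 0 <= r -> cube r x <-> `|x| <= r.
Proof.
move=> r0; split=> [xr|xr i].
  rewrite -[`|x|]/(mx_norm x) mx_normrE; apply/bigmax_leP; split => // -[i j] _/=.
  by rewrite ord1 ler_norml; have := xr j; rewrite !mxE.
rewrite !mxE -ler_norml; apply: le_trans xr.
by rewrite -[`|x|]/(mx_norm x) mx_normrE (le_bigmax _ _ (ord0, i)).
Qed.

Lemma lebesgue_outer_cube_le (r : R) : 0 <= r ->
  (lebesgue_outer (cube r) <= ((2 * r) ^+ n.+1)%:E)%E.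
Proof.
move=> r0; rewrite (le_trans (lebesgue_outer_box_le _ _ _))//.
  by move=> i; rewrite !mxE lerNl (le_trans _ r0)// oppr_le0.
rewrite lee_fin /box_volume (eq_bigr (fun=> 2 * r)) ?prodr_const ?card_ord//.
by move=> i _; rewrite !mxE; ring.
Qed.

(** Every point of an open set lies in a box inside that set with rational
center and edges 2 / (k + 1); there are countably many such boxes. *)
Lemma measurable_open X : open X -> measurable (X : set Vm).
Proof.
move=> oX.
pose F (q : 'rV[rat]_n.+1 * nat) : set V :=
  let c : V := map_mx ratr q.1 in let e : V := const_mx q.2.+1%:R^-1 in
  if `[< box (c - e) (c + e) `<=` X >] then box (c - e) (c + e) else set0.
rewrite (_ : X = \bigcup_q F q); last first.
  apply/seteqP; split => [x Xx|x [q _]]; last first.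
    by rewrite /F; case: ifP => // /asboolP; apply.
  have /nbhs_ballP[e /= e0 xeX] : nbhs x X by exact: open_nbhs_nbhs.
  have [k ke] : exists k, k.+1%:R^-1 < e / 2 :> R.
    have e2 : 0 < e / 2 by rewrite divr_gt0.
    have [k _ /(_ k)] := near_infty_natSinv_lt (PosNum e2).
    by move=> /(_ (leqnn _))/= ke; exists k.
  have k0 : 0 < k.+1%:R^-1 :> R by rewrite invr_gt0.
  have /choice[q xq] : forall i, exists q : rat, `|x 0 i - ratr q| < k.+1%:R^-1.
    move=> i.
    have [|q] := @rat_in_itvoo R (x 0 i - k.+1%:R^-1) (x 0 i + k.+1%:R^-1).
      by rewrite ltrBlDr -addrA ltrDl addr_gt0.
    by rewrite in_itv/= => xq; exists q; rewrite distrC ltr_distl.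
  exists (\row_i q i, k) => //; rewrite /F/=; case: ifPn => [_ i|/asboolPn].
    rewrite !mxE; have := xq i; rewrite ltr_distl => /andP[/ltW-> /ltW->].
    by [].
  case=> y ycb; apply: xeX; split => // i j; rewrite ord1 -ball_normE/=.
  have := ycb j; rewrite !mxE -ler_distl => yq.
  rewrite (le_lt_trans (ler_distD (ratr (q j)) _ _))//.
  by rewrite (splitr e) ltrD// ?(lt_trans (xq j))// distrC (le_lt_trans yq).
apply: countable_bigcupT_measurable => // q; rewrite /F; case: ifP => // _.
exact: measurable_box.
Qed.

(** * Change of variables and hyperplanes *)

Lemma ge0_integral_homothety p c (f : V -> \bar R) : 0 < c ->
  measurable_fun [set: Vm] f -> (forall x, 0 <= f x)%E ->
  (\int[mu]_x f (homothety p c x) = (c ^- n.+1)%:E * \int[mu]_x f x)%E.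
Proof.
move=> c0 mf f0.
have cn0 : 0 <= c ^- n.+1 by rewrite invr_ge0 exprn_ge0 // ltW.
have := @ge0_integral_pushforward _ _ Vm Vm R _ (measurable_homothety p c c0) mu
  setT f measurableT mf (fun y _ => f0 y).
rewrite preimage_setT => <-.
rewrite (eq_measure_integral (mscale (NngNum cn0) mu)).
- by rewrite ge0_integral_mscale.
- exact: measurable_homothety.
- move=> mh A _ _; rewrite [LHS](_ : _ = lam (homothety p c @^-1` A))//.
  by rewrite lebesgue_outer_preimage_homothety.
Qed.

Lemma measurable_hyperplane (a : 'cV[R]_n.+1) (c : R) :
  measurable ([set x | (x *m a) 0 0 = c] : set Vm).
Proof.
have mf : measurable_fun [set: Vm] (fun x : Vm => \sum_i (x : V) 0 i * a i 0).
  apply: measurable_sum => i; apply: measurable_funM => //.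
  exact: measurable_coord.
rewrite (_ : [set x | _] =
    setT `&` (fun x : Vm => \sum_i (x : V) 0 i * a i 0) @^-1` [set c]).
  exact: mf.
by rewrite setTI; apply/seteqP; split => x /=; rewrite mxE.
Qed.

(** A bounded piece of a hyperplane has infinitely many disjoint translates
inside a common cube, all with the same measure. *)
Lemma lebesgue_outer_hyperplane (a : 'cV[R]_n.+1) (c : R) : a != 0 ->
  lam [set x | (x *m a) 0 0 = c] = 0%E.
Proof.
move=> a0; set H := [set x | _].
have [j aj0] : exists j, a j 0 != 0.
  apply/existsP; apply: contra_neqT a0; rewrite negb_exists => /forallP a0.
  by apply/colP => j; apply/eqP; have := a0 j; rewrite negbK mxE.
suff HM (m : nat) : lam (H `&` cube m%:R) = 0%E.
  apply/eqP; rewrite eq_le outer_measure_ge0 andbT.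
  have -> : H = \bigcup_m (H `&` cube m%:R).
    apply/seteqP; split => [x Hx|x [m _ []]//].
    have [m xm] : exists m : nat, `|x| <= m%:R.
      by exists (Num.truncn `|x|).+1; rewrite ltW// truncnS_gt.
    by exists m => //; split => //; apply/cubeE.
  apply: le_trans (outer_measure_sigma_subadditive lam _) _.
  by rewrite eseries0// => k _ _; exact: HM.
set S := H `&` _.
have mS : measurable (S : set Vm).
  by apply: measurableI; [exact: measurable_hyperplane|exact: measurable_box].
(* Along the j-th axis the linear form a is not constant, so distinct
   translates lie in distinct parallel hyperplanes. *)
pose e (k : nat) : V := k.+1%:R^-1 *: delta_mx 0 j.
pose T k := homothety (e k) 1 @` S.
have lT k : lam (T k) = lam S.
  by rewrite lebesgue_outer_homothety// expr1n mul1e.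
have mT k : measurable (T k : set Vm).
  rewrite (_ : T k = homothety (- e k) 1 @^-1` S).
    by rewrite -[X in measurable X]setTI; exact: measurable_homothety.
  by rewrite preimage_homothety// invr1 scale1r opprK.
have tT : trivIset setT T.
  apply/trivIsetP => k l _ _ kl; apply/seteqP; split => // x [[y [Hy _] <-]].
  case=> z [Hz _] /(congr1 (fun w => (w *m a) 0 0)).
  have mxD (A B : 'M[R]_1) : (A + B) 0 0 = A 0 0 + B 0 0 by rewrite mxE.
  rewrite /homothety !scale1r !mulmxDl !mxD Hy Hz => /addIr.
  rewrite /e -!scalemxAl -rowE !mxE => /(mulIf aj0) /invr_inj /eqP.
  by rewrite eqr_nat eqSS eq_sym (negbTE kl).
have TC : \bigcup_k T k `<=` cube (m%:R + 1).
  move=> _ [k _ [x [_ /cubeE xm] <-]]; apply/cubeE; first by rewrite addr_ge0.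
  rewrite /homothety scale1r addrC (le_trans (ler_normD _ _))// lerD//.
    exact: xm.
  have d1 : `|delta_mx 0 j : V| <= 1.
    apply/cubeE => // i; rewrite !mxE eqxx /=; case: (i == j);
      rewrite -?[true%:R]/(1 : R) -?[false%:R]/(0 : R); lra.
  rewrite normrZ ger0_norm ?invr_ge0// (le_trans (ler_piMl _ _) d1)//.
  by rewrite invf_le1 ?ltr0n// ler1n.
have L : (\sum_(0 <= k <oo) lam S < +oo)%E.
  rewrite (eq_eseriesr (g := fun k => mu (T k))); last first.
    by move=> k _; rewrite -(lT k).
  have mUT : measurable (\bigcup_k T k : set Vm) by exact: bigcupT_measurable.
  rewrite (cvg_lim _ (measure_semi_sigma_additive (s := mu) T mT tT mUT))//.
  rewrite (le_lt_trans (le_outer_measure lam _ _ TC))//.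
  by rewrite (le_lt_trans (lebesgue_outer_cube_le _ _)) ?addr_ge0// ltry.
apply/eqP; rewrite eq_le outer_measure_ge0 andbT leNgt; apply/negP => lS0.
have Lge k := @nneseries_lim_ge R (fun=> lam S) xpredT 0 k
  (fun _ _ _ => outer_measure_ge0 lam S).
have lSoo : lam S \is a fin_num.
  by rewrite ge0_fin_numE ?outer_measure_ge0// (le_lt_trans _ L)//
    (le_trans _ (Lge 1%N))// big_nat1.
move: (lam S) lSoo lS0 Lge L => [s| |]// _; rewrite lte_fin => s0.
move: (\sum_(0 <= k <oo) s%:E)%E => [l| |]// Lge _; last first.
  by have := Lge 0%N; rewrite big_nil.
have := Lge (Num.truncn (l / s)).+1.
rewrite sumEFin lee_fin sumr_const_nat subn0 -mulr_natl -ler_pdivlMr//.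
by rewrite leNgt truncnS_gt.
Qed.

(** * Convex sets *)

Definition convex_in X := forall x y (s : R),
  0 <= s <= 1 -> X x -> X y -> X (s *: x + (1 - s) *: y).

(** The weights are not normalized, so that the induction on the number of
points applies to the first m of them as they stand. *)
Lemma convex_in_barycenter X m (w : 'I_m -> R) (x : 'I_m -> V) :
  convex_in X -> (forall i, 0 <= w i) -> 0 < \sum_i w i ->
  (forall i, X (x i)) -> X ((\sum_i w i)^-1 *: \sum_i w i *: x i).
Proof.
move=> cX; elim: m w x => [|m IH] w x w0 ws xX.
  by rewrite big_ord0 ltxx in ws.
rewrite !big_ord_recr/= in ws *.
set S := \sum_(i < m) _ in ws *; set y := \sum_(i < m) _ *: _.
set v := w _ in ws *.
have S0 : 0 <= S by apply: sumr_ge0.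
have v0 : 0 <= v by apply: w0.
have [Seq0|Sneq0] := eqVneq S 0.
  have y0 : y = 0.
    rewrite /y big1// => i _; have /psumr_eq0P := Seq0.
    by move=> ->//; rewrite scale0r.
  rewrite Seq0 add0r in ws *.
  by rewrite y0 add0r scalerA mulVf ?scale1r ?gt_eqF//.
have Sgt0 : 0 < S by rewrite lt_neqAle eq_sym Sneq0.
have -> : (S + v)^-1 *: (y + v *: x ord_max) =
   (S / (S + v)) *: (S^-1 *: y) + (1 - S / (S + v)) *: x ord_max.
  rewrite scalerDr !scalerA; congr (_ *: _ + _ *: _); field; lra.
apply: cX => //; last exact: IH.
by rewrite divr_ge0 ?(ltW ws)//= ler_pdivrMr// mul1r lerDl.
Qed.

(** Near the barycenter of a nondegenerate simplex the barycentric coordinates,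
being continuous, stay positive. Quantitatively: with N = n.+2 vertices, all
coordinates are N^-1 at the barycenter, and it suffices that each of the n.+1
coordinates of the vertices p + row i A moves by less than N ^- 2. *)
Lemma simplex_ball X p (A : 'M[R]_n.+1) : convex_in X ->
  A \in unitmx -> X p -> (forall i, X (p + row i A)) ->
  exists b (e : R), 0 < e /\ forall x, `|x - b| < e -> X x.
Proof.
move=> cX uA Xp XA.
pose N : R := n.+2%:R.
pose K := 1 + \sum_i \sum_j `|invmx A i j|.
have N0 : 0 < N by rewrite ltr0n.
have K0 : 0 < K by rewrite ltr_pwDl// sumr_ge0// => i _; apply: sumr_ge0.
have absK i : \sum_j `|invmx A j i| < K.
  have -> : K = 1 + (\sum_j `|invmx A j i| +
      \sum_(k | k != i) \sum_j `|invmx A j k|).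
    by rewrite /K exchange_big/= [X in 1 + X](bigD1 i).
  by rewrite addrCA ltrDl ltr_pwDl// sumr_ge0// => j _; rewrite sumr_ge0.
exists (p + N^-1 *: \sum_i row i A), (N ^- 2 / K); split.
  by rewrite !(divr_gt0, invr_gt0, exprn_gt0).
move=> x; set b := p + _; set h := x - b => hK.
(* At x = b + h, the vertex p + row i A has weight N^-1 + l 0 i. *)
pose l := h *m invmx A.
have lN i : `|l 0 i| < N ^- 2.
  rewrite mxE (le_lt_trans (ler_norm_sum _ _ _))//.
  apply: (@le_lt_trans _ _ (\sum_j `|h| * `|invmx A j i|)).
    apply: ler_sum => j _; rewrite normrM ler_wpM2r//.
    rewrite -[leRHS]/(mx_norm h) mx_normrE.
    by rewrite (le_bigmax _ (fun ij => `|h ij.1 ij.2|) (0, j)).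
  rewrite -mulr_sumr; rewrite ltr_pdivlMr// in hK.
  apply: le_lt_trans hK; apply: ler_wpM2l => //; exact: ltW.
pose w i := N^-1 + l 0 i.
have N12 : N ^- 2 <= N^-1.
  by rewrite lef_pV2 ?posrE ?exprn_gt0// expr2 ler_peMr ?ltW// ltr1n.
have w0 i : 0 < w i.
  have := lN i; rewrite ltr_norml => /andP[lNi _].
  by rewrite /w -ltrBlDl sub0r (le_lt_trans _ lNi)// lerN2.
have W0 : 0 < \sum_i w i.
  by rewrite big_ord_recl ltr_pwDl// sumr_ge0// => i _; rewrite ltW.
have W1 : \sum_i w i <= 1.
  apply: (@le_trans _ _ (\sum_(i < n.+1) (N^-1 + N ^- 2))).
    by apply: ler_sum => i _; rewrite /w lerD2l (le_trans (ler_norm _))// ltW.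
  rewrite sumr_const card_ord -mulr_natl /N -(natr1 n.+1).
  set M := n.+1%:R; have M0 : 0 <= M :> R by [].
  have -> : M * ((M + 1)^-1 + (M + 1) ^- 2) = 1 - (M + 1) ^- 2.
    by field; rewrite gt_eqF// ltr_wpDl.
  by rewrite lerBlDr lerDl invr_ge0 exprn_ge0// addr_ge0.
have wE : \sum_i w i *: (p + row i A) =
    (\sum_i w i) *: p + N^-1 *: (\sum_i row i A) + h.
  transitivity (\sum_i (w i *: p + (N^-1 *: row i A + l 0 i *: row i A))).
    by apply: eq_bigr => i _; rewrite scalerDr [X in _ + X]scalerDl.
  rewrite big_split/= big_split/= -scaler_suml -scaler_sumr -mulmx_sum_row.
  by rewrite /l mulmxKV// addrA.
have -> : x = (1 - \sum_i w i) *: p +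
    (1 - (1 - \sum_i w i)) *: ((\sum_i w i)^-1 *: \sum_i w i *: (p + row i A)).
  rewrite opprB addrCA subrr addr0 scalerA mulfV ?gt_eqF// scale1r wE.
  rewrite -[LHS](subrKC b) -/h !addrA -scalerDl.
  by rewrite [X in X *: p](_ : _ = 1) ?scale1r// subrK.
apply: (cX) => //.
  by rewrite subr_ge0 W1/= lerBlDr lerDl ltW.
by apply: (convex_in_barycenter _ _ _ _ cX) => // i; exact: ltW (w0 i).
Qed.

(** Take a family of differences x - p with x in X of maximal rank. If it spans,
it contains a basis; otherwise it cannot be enlarged, so X lies in the proper
affine subspace it generates. *)
Lemma hyperplane_or_simplex X p : X p ->
  (exists2 a : 'cV[R]_n.+1,
    a != 0 & forall x, X x -> (x *m a) 0 0 = (p *m a) 0 0)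
  \/ (exists2 A : 'M[R]_n.+1, A \in unitmx & forall i, X (p + row i A)).
Proof.
move=> Xp.
pose P (k : nat) := `[< exists m (A : 'M[R]_(m, n.+1)),
   \rank A = k /\ forall i, X (p + row i A) >].
have exP : exists k, P k.
  exists 0%N; apply/asboolP; exists 0%N, 0; split; first by rewrite mxrank0.
  by case.
have Pub k : P k -> (k <= n.+1)%N.
  by move=> /asboolP[m [A [<- _]]]; exact: rank_leq_col.
case: (ex_maxnP exP Pub) => r /asboolP[m [A [rA XA]]] rmax.
have [rn|rn] := eqVneq r n.+1.
  right; have fA : row_full A by rewrite /row_full rA rn.
  exists (rowsub (fullrankfun fA) A); first exact: fullrowsub_unit.
  by move=> i; rewrite row_rowsub.
left; have {}rn : (r < n.+1)%N by rewrite ltn_neqAle rn -rA rank_leq_col.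
have sA x : X x -> ((x - p) <= A)%MS.
  move=> Xx; have : P (\rank (col_mx A (x - p))).
    apply/asboolP; exists (m + 1)%N, (col_mx A (x - p)); split=> // i.
    case: (split_ordP i) => j ->.
      by rewrite rowKu.
    by rewrite rowKd ord1 row_id addrC subrK.
  move=> /rmax; rewrite -rA => le.
  have : (col_mx A (x - p) <= A)%MS.
    have AB : (A <= col_mx A (x - p))%MS by rewrite -addsmxE addsmxSl.
    by rewrite -(geq_leqif (mxrank_leqif_sup AB)).
  by rewrite col_mx_sub => /andP[].
have [j aj] : exists j, col j (cokermx A) != 0.
  apply/existsP; apply: contraTT rn; rewrite negb_exists => /forallP a0.
  rewrite -leqNgt -rA -subn_eq0 -mxrank_coker mxrank_eq0; apply/eqP/matrixP => i j.
  by have := a0 j; rewrite negbK => /eqP/colP/(_ i); rewrite !mxE.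
exists (col j (cokermx A)) => // x /sA; rewrite submxE mulmxBl subr_eq0.
by rewrite colE !mulmxA => /eqP ->.
Qed.

Lemma nonnull_simplex X : lam X != 0%E ->
  exists p (A : 'M[R]_n.+1), [/\ A \in unitmx, X p & forall i, X (p + row i A)].
Proof.
have [->|/set0P[p Xp] X0] := eqVneq X set0.
  by rewrite outer_measure0 eqxx.
have [[a a0 Xa]|[A uA XA]] := hyperplane_or_simplex X p Xp; last by exists p, A.
exfalso; move/eqP: X0; apply; apply/eqP; rewrite eq_le outer_measure_ge0 andbT.
by rewrite -(lebesgue_outer_hyperplane a ((p *m a) 0 0) a0) le_outer_measure.
Qed.

Lemma convex_in_ball X : convex_in X -> lam X != 0%E ->
  exists b (e : R), 0 < e /\ forall x, `|x - b| < e -> X x.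
Proof.
by move=> cX /nonnull_simplex[p [A [uA Xp XA]]]; exact: simplex_ball cX uA Xp XA.
Qed.

Lemma measurable_null X : lam X = 0%E -> measurable (X : set Vm).
Proof.
move=> X0; apply: le_caratheodory_measurable => Y.
have YX0 : lam (Y `&` X) = 0%E.
  by apply/eqP; rewrite eq_le outer_measure_ge0 andbT -X0 le_outer_measure.
by rewrite [X in (X + _)%E]YX0 add0e; apply: le_outer_measure; exact: subIsetl.
Qed.

(** The homothety of center b and ratio t < 1 maps the closure of X into the
interior of X; letting t tend to 1, both have the same finite measure, and X
differs from its interior by a null set. *)
Lemma measurable_convex_ball X b (e r : R) : convex_in X -> 0 < e -> 0 <= r ->
  (forall x, `|x - b| < e -> X x) -> X `<=` cube r -> measurable (X : set Vm).
Proof.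
move=> cX e0 r0 bX Xr.
have mO : measurable (X° : set Vm) by apply: measurable_open; exact: open_interior.
have mK : measurable (closure X : set Vm).
  by rewrite -[closure X]setCK; apply: measurableC; apply: measurable_open;
    apply: closed_openC; exact: closed_closure.
(* A point z near the image of x in the closure is a convex combination
   t y + (1 - t) w with y in X near x, and then w is near b. *)
have KO (t : R) : 0 < t < 1 -> closure X `<=` homothety ((1 - t) *: b) t @^-1` X°.
  move=> /andP[t0 t1] x Kx; apply/nbhs_ballP.
  have t1' : 0 < 1 - t by rewrite subr_gt0.
  have d0 : 0 < (1 - t) * e / 2 by rewrite !mulr_gt0 ?invr_gt0.
  exists ((1 - t) * e / 2) => // z; rewrite -ball_normE/= => xz.
  have [y [Xy]] := Kx _ (nbhsx_ballx x ((1 - t) * e / 2 / t) (divr_gt0 d0 t0)).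
  rewrite -ball_normE/= => xy.
  have -> : z = t *: y + (1 - t) *: ((1 - t)^-1 *: (z - t *: y)).
    by rewrite scalerA mulfV ?gt_eqF// scale1r addrC subrK.
  apply: cX => //; first by rewrite !ltW.
  apply: bX.
  have -> : (1 - t)^-1 *: (z - t *: y) - b =
      (1 - t)^-1 *: (t *: (x - y) - (homothety ((1 - t) *: b) t x - z)).
    apply: (scalerI (lt0r_neq0 t1')); rewrite scalerBr !scalerA.
    rewrite mulfV ?gt_eqF// !scale1r /homothety.
    by apply/rowP => i; rewrite !mxE; ring.
  rewrite normrZ gtr0_norm ?invr_gt0// mulrC ltr_pdivrMr//.
  rewrite (le_lt_trans (ler_normB _ _))//.
  have -> : e * (1 - t) = (1 - t) * e / 2 + (1 - t) * e / 2 by field.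
  rewrite ltrD// normrZ gtr0_norm//; move: xy.
  by rewrite ltr_pdivlMr// mulrC.
have XK : lam (closure X `\` X°) = 0%E.
  have lO : (lam X° < +oo)%E.
    have XOr : X° `<=` cube r by exact: subset_trans (@interior_subset _ X) Xr.
    rewrite (le_lt_trans (le_outer_measure lam _ _ XOr))//.
    by rewrite (le_lt_trans (lebesgue_outer_cube_le _ r0)) ?ltry.
  have OK : X° `<=` closure X.
    exact: subset_trans (@interior_subset _ X) (@subset_closure _ X).
  have lK (t : R) : 0 < t < 1 -> (lam (closure X) <= (t ^- n.+1)%:E * lam X°)%E.
    move=> t01; rewrite -(lebesgue_outer_preimage_homothety ((1 - t) *: b) t).
      by apply: le_outer_measure; exact: KO.
    by case/andP: t01.
  have lKoo : (lam (closure X) < +oo)%E.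
    have h01 : 0 < 2^-1 :> R by rewrite invr_gt0.
    have h1 : 2^-1 < 1 :> R by rewrite invf_lt1 ?ltr1n.
    have {}h01 : 0 < (2^-1 : R) < 1 by rewrite h01 h1.
    by rewrite (le_lt_trans (lK _ h01))// lte_mul_pinfty// lee_fin invr_ge0.
  have lKO : (lam (closure X) <= lam X°)%E.
    have Of : lam X° \is a fin_num by rewrite ge0_fin_numE ?outer_measure_ge0.
    have Kf : lam (closure X) \is a fin_num.
      by rewrite ge0_fin_numE ?outer_measure_ge0.
    move: Of Kf lK; move: (lam X°) => [v| |]// _.
    move: (lam (closure X)) => [k| |]// _ lK.
    rewrite lee_fin.
    have tk : t ^+ n.+1 * k @[t --> (1:R)^'-] --> 1 ^+ n.+1 * k.
      apply: cvgM; last exact: cvg_cst.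
      by apply: cvg_at_left_filter; exact: exprn_continuous.
    suff : 1 ^+ n.+1 * k <= v by rewrite expr1n mul1r.
    apply: (cvgr_to_le tk).
    near=> t.
    have t0 : 0 < t by near: t; exact: nbhs_left_gt.
    have t1 : t < 1 by near: t; exact: nbhs_left_lt.
    have := lK t; rewrite t0 t1 => /(_ isT).
    by rewrite -EFinM lee_fin mulrC ler_pdivlMr ?exprn_gt0// mulrC.
  have E : mu (closure X) = mu X°.
    apply/eqP; rewrite eq_le; apply/andP; split; first exact: lKO.
    exact: (le_outer_measure lam _ _ OK).
  have Of : mu X° \is a fin_num.
    by rewrite ge0_fin_numE; [exact: lO|exact: outer_measure_ge0].
  have := @measureD _ _ _ mu _ _ mK mO lKoo.
  rewrite setIidr// => D; apply: (etrans D).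
  by rewrite [X in (X - _)%E](E : _ = _) subee.
rewrite (_ : X = X° `|` (X `\` X°)); last first.
  by rewrite setDUK//; exact: interior_subset.
apply: measurableU => //; apply: measurable_null.
apply/eqP; rewrite eq_le outer_measure_ge0 andbT -XK le_outer_measure//.
by apply: setSD; exact: subset_closure.
Unshelve. all: by end_near. Qed.

Lemma measurable_convex X : convex_in X -> measurable (X : set Vm).
Proof.
move=> cX.
have -> : X = \bigcup_m (X `&` cube m%:R).
  apply/seteqP; split => [x Xx|x [m _ []]//].
  exists (Num.truncn `|x|).+1 => //; split => //; apply/cubeE => //.
  by rewrite ltW// truncnS_gt.
apply: bigcupT_measurable => m; set Y := _ `&` _.
have cY : convex_in Y.
  move=> x y s s01 [Xx xm] [Xy ym]; split; first exact: cX.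
  case/andP: s01 => s0 s1.
  apply/cubeE => //; rewrite (le_trans (ler_normD _ _))// !normrZ.
  move/cubeE : xm => /(_ (ler0n _ _)) xm; move/cubeE : ym => /(_ (ler0n _ _)) ym.
  rewrite !ger0_norm ?subr_ge0//.
  rewrite (@le_trans _ _ (s * m%:R + (1 - s) * m%:R))//.
    by rewrite lerD// ler_wpM2l// subr_ge0.
  by rewrite -mulrDl addrC subrK mul1r.
have [Y0|/(convex_in_ball _ cY)[b [e [e0 bY]]]] := eqVneq (lam Y) 0%E.
  exact: measurable_null.
by apply: (measurable_convex_ball Y b e m%:R) => // x [].
Qed.

(** * Convex coercive functions *)

(** Coercivity is stated with the Euclidean norm, whereas the norm of row vectors
is the supremum norm. *)
Lemma norm_le_euclidean (x : V) : `|x| <= euclidean_norm x.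
Proof.
rewrite -[`|x|]/(mx_norm x) mx_normrE; apply/bigmax_leP.
split=> [|[i j] _ /=]; first exact: sqrtr_ge0.
rewrite ord1 -sqrtr_sqr ler_wsqrtr// (bigD1 j)//= lerDl sumr_ge0// => k _.
exact: sqr_ge0.
Qed.

Lemma convex_in_sublevel u (r : R) : (forall x, u x != -oo%E) -> econvex u ->
  convex_in [set x | (u x < r%:E)%E].
Proof.
move=> uNy cu x y s s01; have /andP[s0 s1] := s01; have := cu x y s s01.
rewrite /=; move: (uNy x) (uNy y); case: (u x) => [v| |]//; case: (u y) => [w| |]//.
move=> _ _ le; rewrite !lte_fin => vr wr; apply: (le_lt_trans le).
rewrite -!EFinM -EFinD lte_fin.
have -> : r = s * r + (1 - s) * r by ring.
have [->|sN0] := eqVneq s 0; first by rewrite !mul0r !add0r subr0 !mul1r.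
have sgt0 : 0 < s by rewrite lt_neqAle eq_sym sN0.
apply: ltr_leD; first by rewrite ltr_pM2l.
by rewrite ler_wpM2l ?subr_ge0// ltW.
Qed.

Lemma measurable_econvex u : (forall x, u x != -oo%E) -> econvex u ->
  measurable_fun [set: Vm] u.
Proof.
move=> uNy cu mT; apply: (measurability _ (ErealGenInftyO.measurableE R)) => //.
move=> _ [_ [r ->] <-]; rewrite setTI.
rewrite [X in measurable X](_ : _ = [set x : V | (u x < r%:E)%E]).
  exact/measurable_convex/convex_in_sublevel.
by apply/seteqP; split => x /=; rewrite in_itv.
Qed.

(** A convex function that is finite on a set of positive measure is bounded
above by some M on a ball of center b and radius e. Far from b, coercivity
gives u >= u b + 1 on a sphere, and convexity on rays from b propagates this
into linear growth. Near b, the point b is a convex combination of x and of a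
point of the ball, so u x cannot be too small. *)
Lemma classL_linear_growth u : classL u -> lam (edom u) != 0%E ->
  exists a c : R, 0 < a /\ forall x, ((a * `|x| - c)%:E <= u x)%E.
Proof.
move=> [uNy _ cu coer] dom0.
have [p [A [uA up uA_fin]]] := nonnull_simplex (edom u) dom0.
pose M := 1 + (`|fine (u p)| + \sum_i `|fine (u (p + row i A))|).
have pM : (u p < M%:E)%E.
  rewrite -(fineK up) lte_fin /M ltr_pwDl// (le_trans (ler_norm _))// lerDl.
  by rewrite sumr_ge0.
have AM i : (u (p + row i A)%R < M%:E)%E.
  rewrite -(fineK (uA_fin i)) lte_fin /M ltr_pwDl// (le_trans (ler_norm _))//.
  by rewrite (bigD1 i)//= addrCA lerDl addr_ge0// sumr_ge0.
have [b [e [e0 bM]]] :=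
  simplex_ball _ _ _ (convex_in_sublevel u M uNy cu) uA pM AM.
have ub : u b \is a fin_num.
  have := bM b; rewrite subrr normr0 => /(_ e0) /=; move: (uNy b).
  by case: (u b).
pose c0 := fine (u b).
have bE : u b = c0%:E by rewrite fineK.
have [r0 r0P] := coer (c0 + 1).
(* the radius of a sphere around b that lies outside the r0-ball around 0 *)
pose rho := `|b| + (`|r0| + 1).
have rho0 : 0 < rho by rewrite ltr_wpDl// ltr_wpDl.
(* the largest weight s0 for which b = s0 x + (1 - s0) y and |x - b| < rho
   ensure |y - b| < e *)
pose s0 := e / (e + rho).
pose m := (c0 - (1 - s0) * M) / s0.
exists rho^-1, (rho^-1 * `|b| + (1 + `|m| + `|c0|)).
split; first by rewrite invr_gt0.
move=> x.
suff : ((rho^-1 * `|x - b| - (1 + `|m| + `|c0|))%:E <= u x)%E.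
  apply: le_trans; rewrite lee_fin opprD addrA lerD2r -mulrBr ler_pM2l ?invr_gt0//.
  by rewrite lerBlDr -{1}(subrK b x) ler_normD.
have [ux|] := boolP (u x \is a fin_num); last first.
  by move: (uNy x); case: (u x) => // _ _; rewrite leey.
rewrite -(fineK ux); set v := fine (u x); rewrite lee_fin.
have vE : u x = v%:E by rewrite fineK.
have [xrho|xrho] := leP rho `|x - b|.
  pose s := rho / `|x - b|.
  have xb0 : 0 < `|x - b| by apply: lt_le_trans xrho.
  have s01 : 0 <= s <= 1.
    by rewrite divr_ge0 ?(ltW rho0)//= ler_pdivrMr// mul1r.
  have sgt0 : 0 < s by rewrite divr_gt0.
  have /r0P yc : r0 < euclidean_norm (s *: x + (1 - s) *: b).
    rewrite (lt_le_trans _ (norm_le_euclidean _))//.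
    have -> : s *: x + (1 - s) *: b = s *: (x - b) + b.
      by rewrite scalerBl scale1r scalerBr; apply/rowP => i; rewrite !mxE; ring.
    rewrite (lt_le_trans _ (lerB_normD _ _))// normrZ gtr0_norm//.
    rewrite /s mulfVK ?gt_eqF// /rho addrAC subrr add0r.
    by rewrite (le_lt_trans (ler_norm _))// ltrDl.
  have := lt_le_trans yc (cu x b s s01).
  rewrite vE bE -!EFinM -EFinD lte_fin => h.
  have h1 : 1 < s * (v - c0) by lra.
  have : rho^-1 * `|x - b| < v - c0.
    rewrite -(ltr_pM2l sgt0); have -> : s * (rho^-1 * `|x - b|) = 1.
      by rewrite /s; field; rewrite !gt_eqF.
    exact: h1.
  move=> h2.
  have := ler_norm c0; have := ler_norm (- c0); rewrite normrN.
  have := normr_ge0 m; move: h2; set q := _ * _; lra.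
have s0gt0 : 0 < s0 by rewrite divr_gt0// addr_gt0.
have s0lt1 : s0 < 1.
  by rewrite /s0 ltr_pdivrMr; [rewrite mul1r ltrDl|exact: addr_gt0].
pose y := b - (s0 / (1 - s0)) *: (x - b).
have s01 : 0 <= s0 <= 1 by rewrite !ltW.
have yM : (u y < M%:E)%E.
  apply: bM; rewrite /y addrAC subrr add0r normrN normrZ gtr0_norm; last first.
    by rewrite divr_gt0// subr_gt0.
  have -> : s0 / (1 - s0) = e / rho.
    apply/eqP; rewrite eqr_div ?(gt_eqF rho0) ?(gt_eqF (_ : 0 < 1 - s0))
      ?subr_gt0//.
    by apply/eqP; rewrite /s0; field; exact: lt0r_neq0 (addr_gt0 e0 rho0).
  by rewrite mulrAC ltr_pdivrMr // ltr_pM2l.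
have := cu x y s0 s01.
have -> : s0 *: x + (1 - s0) *: y = b.
  rewrite /y scalerBr scalerA mulrC divfK ?subr_eq0 ?(gt_eqF s0lt1)//.
  by apply/rowP => i; rewrite !mxE; ring.
rewrite bE vE; move: yM (uNy y); case: (u y) => [w| |]// + _.
rewrite lte_fin -!EFinM -EFinD lee_fin => wM h.
have mv : m <= v.
  rewrite /m ler_pdivrMr// [leRHS]mulrC lerBlDr (le_trans h)// lerD2l.
  by rewrite ler_wpM2l ?subr_ge0// ltW.
have : rho^-1 * `|x - b| < 1 by rewrite ltr_pdivrMl// mulr1.
have := ler_norm (- m); have := normr_ge0 c0; rewrite normrN.
by move: mv; set q := _ * _; lra.
Qed.

(** On the shell k <= |x| < k + 1, which lies in a cube of volume
(2 (k + 1)) ^ n.+1, the bound is at most C exp (- a k). Half of this decay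
absorbs the volume; the other half leaves a geometric series. *)
Lemma integral_lty_expR_decay (f : V -> \bar R) (a C : R) : 0 < a -> 0 <= C ->
  measurable_fun [set: Vm] f -> (forall x, 0 <= f x)%E ->
  (forall x, f x <= (C * expR (- (a * `|x|)))%:E)%E ->
  (\int[mu]_x f x < +oo)%E.
Proof.
move=> a0 C0 mf f0 fC.
pose g (k : nat) (x : V) : \bar R :=
  (C * expR (- (a * k%:R)) * \1_(cube k.+1%:R) x)%:E.
have g0 k x : (0 <= g k x)%E.
  by rewrite lee_fin !mulr_ge0 ?expR_ge0.
have mg k : measurable_fun [set: Vm] (g k).
  apply/measurable_EFinP/measurable_funM => //.
  by apply: measurable_indic; exact: measurable_box.
have fg x : (f x <= \sum_(0 <= k <oo) g k x)%E.
  pose k := Num.truncn `|x|.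
  apply: le_trans (fC x) _.
  apply: (@le_trans _ _ (\sum_(0 <= i < k.+1) g i x)%E); last first.
    by apply: nneseries_lim_ge => i _ _; exact: g0.
  rewrite big_nat_recr//=; apply: (@le_trans _ _ (g k x)); last first.
    by rewrite leeDr// sume_ge0.
  have /andP[kx xk] : k%:R <= `|x| < k.+1%:R by rewrite truncn_itv.
  rewrite lee_fin indicE mem_set ?mulr1; last by apply/cubeE => //; exact: ltW.
  by rewrite ler_wpM2l// ler_expR lerN2 ler_pM2l.
apply: (@le_lt_trans _ _ (\int[mu]_x (\sum_(0 <= k <oo) g k x))%E).
  apply: ge0_le_integral => //.
  by apply: ge0_emeasurable_sum.
rewrite integral_nneseries//.
pose q := expR (- (a / 2)).
(* With y = a (k + 1) / 2, the volume is (4 y / a) ^ n.+1, and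
   y ^ n.+1 / (n.+1)! <= exp y. *)
pose K := C * ((4 / a) ^+ n.+1 * n.+1`!%:R * expR (a / 2)).
have gK k : (\int[mu]_x g k x <= (geometric K q k)%:E)%E.
  have c0 : 0 <= C * expR (- (a * k%:R)) by rewrite mulr_ge0// expR_ge0.
  have mC : measurable (cube k.+1%:R : set Vm) by exact: measurable_box.
  rewrite (eq_integral (fun x : Vm => (C * expR (- (a * k%:R)))%:E *
    (\1_(cube k.+1%:R : set V) (x : V))%:E)%E)//.
  rewrite ge0_integralZl//; last first.
    by apply/measurable_EFinP; exact: measurable_indic.
  rewrite integral_indic// setIT.
  apply: (@le_trans _ _
    ((C * expR (- (a * k%:R)))%:E * ((2 * k.+1%:R) ^+ n.+1)%:E)%E).
    by apply: lee_pmul => //; exact: lebesgue_outer_cube_le.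
  rewrite -EFinM lee_fin /geometric/= /K -!mulrA ler_wpM2l//.
  pose y := a / 2 * k.+1%:R.
  have y0 : 0 <= y by rewrite mulr_ge0// divr_ge0// ltW.
  have -> : 2 * k.+1%:R = 4 / a * y.
    by rewrite /y; field; rewrite gt_eqF.
  rewrite exprMn.
  have yn : y ^+ n.+1 <= n.+1`!%:R * expR y.
    have := expR_ge1Dxn n y0; rewrite -ler_pdivrMl ?ltr0n ?fact_gt0//.
    by apply: le_trans; rewrite mulrC lerDr.
  have qE : expR (- (a * k%:R)) * expR y = expR (a / 2) * q ^+ k.
    rewrite /q -expRM_natr -!expRD; congr expR.
    by rewrite /y -(natr1 k); field.
  rewrite mulrCA ler_wpM2l ?exprn_ge0 ?divr_ge0 ?(ltW a0)//.
  by rewrite -qE mulrCA ler_wpM2l// expR_ge0.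
have q1 : q < 1 by rewrite expR_lt1 oppr_lt0 divr_gt0.
apply: (@le_lt_trans _ _ (K * (1 - q)^-1)%:E); last exact: ltry.
apply: lime_le.
  by apply: is_cvg_nneseries => k _ _; exact: integral_ge0.
apply: nearW => m.
rewrite (@le_trans _ _ (\sum_(0 <= k < m) (geometric K q k)%:E)%E)//.
  by apply: lee_sum => k _; exact: gK.
rewrite sumEFin lee_fin; apply: geometric_le_lim.
- by rewrite !mulr_ge0 ?exprn_ge0 ?divr_ge0 ?expR_ge0 ?(ltW a0).
- exact: expR_gt0.
- by rewrite gtr0_norm ?expR_gt0.
Qed.

(** * The perturbed integral *)

(** The value at y is bounded below by convexity at the point
x / (1 + t) = (x - y) / (1 + t) + (t / (1 + t)) (y / t), with equality at
y = t x / (1 + t). *)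
Lemma infconv_rscale u t x : 0 < t -> (forall y, u y != -oo%E) -> econvex u ->
  infconv u (rscale u t) x = ((1 + t)%:E * u ((1 + t)^-1 *: x))%E.
Proof.
move=> t0 uNy cu; have t1 : 0 < 1 + t by rewrite addr_gt0.
set z := _ *: x; have -> : x = (1 + t) *: z.
  by rewrite scalerA mulfV ?gt_eqF// scale1r.
move: z => z; apply/eqP; rewrite eq_le; apply/andP; split.
  apply: ereal_inf_lbound; exists (t *: z) => //.
  rewrite /rscale gt_eqF// scalerA mulVf ?gt_eqF// scale1r.
  rewrite -scalerBl addrK scale1r.
  move: (uNy z); case: (u z) => [v| |]// _.
    by rewrite -!EFinM -EFinD; congr EFin; ring.
  by rewrite !gt0_muley ?lte_fin// addye.
apply: le_ereal_inf_tmp => _ [y _ <-]; rewrite /rscale gt_eqF//.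
have s01 : 0 <= (1 + t)^-1 <= 1.
  by rewrite invr_ge0 (ltW t1)/= invf_le1// lerDl ltW.
have := cu ((1 + t) *: z - y) (t^-1 *: y) _ s01.
have -> : (1 + t)^-1 *: ((1 + t) *: z - y) + (1 - (1 + t)^-1) *: (t^-1 *: y) = z.
  apply/rowP => i; rewrite !mxE; field.
  by rewrite !gt_eqF.
move: (uNy ((1 + t) *: z - y)) (uNy (t^-1 *: y)).
case: (u ((1 + t) *: z - y)) => [v| |]//;
  case: (u (t^-1 *: y)) => [w| |]//; last first.
- by move=> _ _ _; rewrite gt0_muley ?lte_fin// addye// leey.
- by move=> _ _ _; rewrite addye// leey.
- by move=> _ _ _; rewrite gt0_muley ?lte_fin// addey// leey.
move=> _ _; rewrite -!EFinM -!EFinD => h.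
rewrite -lee_pdivlMl//; apply: le_trans h _.
rewrite -EFinM lee_fin le_eqVlt; apply/orP; left; apply/eqP; field.
by rewrite gt_eqF.
Qed.

Lemma potentialK u : potential (fun x => expeR (- u x)) = u.
Proof. by apply/funext => x; rewrite /potential expeRK oppeK. Qed.

Lemma measurable_expeR : measurable_fun [set: \bar R] (@expeR R).
Proof.
move=> mT; apply: (measurability _ (ErealGenInftyO.measurableE R)) => //.
move=> _ [_ [r ->] <-]; rewrite setTI.
rewrite [X in measurable X](_ : _ = `]-oo, lne r%:E[%classic); last first.
  apply/seteqP; suff E (y : \bar R) : (expeR y < r%:E)%E = (y < lne r%:E)%E.
    by split => y /=; rewrite !in_itv/= E.
  have [r0|r0] := leP 0 r.
    have /eqP {1}<- : expeR (lne r%:E) == r%:E by rewrite lneK_eq lee_fin.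
    exact: lte_expeR.
  rewrite le0_lneNy ?lee_fin ?ltW// [RHS]ltNge leNye/=.
  by apply/negbTE; rewrite -leNgt (le_trans _ (expeR_ge0 _))// lee_fin ltW.
exact: emeasurable_itv.
Qed.

Lemma measurable_expeR_scale u s : measurable_fun [set: Vm] u ->
  measurable_fun [set: Vm] (fun x => expeR (- (s%:E * u x))%E).
Proof.
move=> mu_; apply: (measurableT_comp measurable_expeR).
by apply: measurableT_comp => //; exact: measurable_funeM.
Qed.

Lemma J_oplus u t : classL u -> 0 < t ->
  J (oplus (fun x => expeR (- u x)%E) t (fun x => expeR (- u x)%E)) =
  (((1 + t) ^+ n.+1)%:E * \int[mu]_x expeR (- ((1 + t)%:E * u x)))%E.
Proof.
move=> [uNy _ cu _] t0; have t1 : 0 < 1 + t by rewrite addr_gt0.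
rewrite /J /oplus !potentialK.
under eq_integral do rewrite infconv_rscale//.
have := ge0_integral_homothety 0 (1 + t)^-1
  (fun x => expeR (- ((1 + t)%:E * u x))%E).
rewrite invr_gt0 exprVn invrK => <- //.
- by apply: eq_integral => x _; rewrite /homothety add0r.
- apply: measurable_expeR_scale; exact: measurable_econvex.
- by move=> x; exact: expeR_ge0.
Qed.

Lemma measurable_edom u :
  measurable_fun [set: Vm] u -> measurable (edom u : set Vm).
Proof.
by move=> mu_; rewrite -[X in measurable X]setTI; exact: emeasurable_fin_num.
Qed.

(** Real-valued integrands on the domain of u are needed to differentiate under
the integral sign. *)
Lemma integral_edom u (g : \bar R -> \bar R) :
  (forall x, u x != -oo%E) -> g +oo%E = 0%E ->
  (\int[mu]_x g (u x) = \int[mu]_(x in edom u) g (fine (u x))%:E)%E.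
Proof.
move=> uNy g0; rewrite [RHS]integral_mkcond; apply: eq_integral => x _.
rewrite patchE; case: ifPn => [|/negP]; rewrite inE /edom/= => ux.
  by rewrite fineK.
by move: (uNy x) ux; case: (u x).
Qed.

Section derivative.
Context u (uL : classL u) (u0 : lam (edom u) != 0%E).

Let D := edom u.
Let v x := fine (u x).
(* the integrand of J (f (+) t . f) after the homothety, up to the factor
   (1 + t) ^ n.+1 *)
Let F t x := expR (- (1 + t) * v x).

Let um : measurable_fun [set: Vm] u.
Proof. by case: uL => uNy _ cu _; exact: measurable_econvex. Qed.

Let mD : measurable (D : set Vm). Proof. exact: measurable_edom. Qed.

Let vm : measurable_fun [set: Vm] v.
Proof. exact: measurableT_comp um. Qed.

Lemma integrable_expR_scale s : 0 < s ->
  mu.-integrable D (fun x => (expR (- s * v x))%:E).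
Proof.
move=> s0; have [uNy _ cu _] := uL.
apply/integrableP; split.
  apply: measurable_funTS; apply/measurable_EFinP.
  by apply: measurableT_comp => //; exact: measurable_funM.
under eq_integral => x _ do rewrite abse_EFin ger0_norm ?expR_ge0//.
have := integral_edom u (fun w => expeR (- (s%:E * w))%E) uNy.
rewrite gt0_muley ?lte_fin// => /(_ erefl).
under [X in _ = X -> _]eq_integral => x _ do rewrite /= -mulNr.
move=> <-; have [a [c [a0 uac]]] := classL_linear_growth u uL u0.
apply: (integral_lty_expR_decay _ (s * a) (expR (s * c))).
- exact: mulr_gt0.
- exact: expR_ge0.
- exact: measurable_expeR_scale.
- by move=> x; exact: expeR_ge0.
move=> x; rewrite -expRD.
have : expeR (s * c - s * a * `|x|)%:E = (expR (s * c - s * a * `|x|))%:E by [].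
move=> <-; rewrite lee_expeR leeNl -EFinN.
have -> : - (s * c - s * a * `|x|) = s * (a * `|x| - c) by ring.
by rewrite EFinM lee_pmul2l.
Qed.

Lemma derivative_expR_scale t x :
  is_derive t 1 (F^~ x) (- v x * F t x).
Proof.
have g : is_derive t 1 (fun t => - (1 + t) * v x) (- v x).
  have -> : (fun t => - (1 + t) * v x) = ((- v x) \*: id) + cst (- v x).
    by apply/funext => r; rewrite -[RHS]/(- v x * r + - v x); ring.
  apply: is_derive_eq; rewrite subr0; exact: mulr1.
have := @is_derive1_comp R expR (fun t => - (1 + t) * v x) t _ _
  (is_derive_expR _) g.
by rewrite mulrC.
Qed.

(** For |t| < 1/4 the exponent - (1 + t) v leaves at least v / 4 of decay beyond
v / 2 when v >= 0, and v <= 4 exp (v / 4); when v < 0 everything is bounded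
because v is bounded below. *)
Lemma dominated_derivative_expR : exists G : V -> R, [/\ forall x, 0 <= G x,
  mu.-integrable D (EFin \o G) & forall t x,
  `]- 4^-1, 4^-1[%classic t -> D x -> `|v x * F t x| <= G x].
Proof.
have [a [c [a0 uac]]] := classL_linear_growth u uL u0.
pose K := 4 + `|c| * expR `|c|.
have K0 : 0 <= K by rewrite addr_ge0// mulr_ge0// expR_ge0.
exists (fun x => K * expR (- 2^-1 * v x)); split.
- by move=> x; rewrite mulr_ge0// expR_ge0.
- under [X in integrable _ _ X]eq_fun do rewrite /= EFinM.
  apply: integrableZl => //; apply: integrable_expR_scale.
  by rewrite invr_gt0.
move=> t x; rewrite /= in_itv/= => /andP[t1 t2] Dx.
have : - `|c| <= v x.
  rewrite -lee_fin /v fineK//; apply: le_trans (uac x); rewrite lee_fin.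
  rewrite lerBrDr (le_trans _ (mulr_ge0 (ltW a0) (normr_ge0 x)))//.
  by rewrite addrC subr_le0 ler_norm.
rewrite /F; move: (v x) => w wc.
rewrite normrM (ger0_norm (expR_ge0 _)).
have [w0|w0] := leP 0 w.
  rewrite ger0_norm//.
  apply: (@le_trans _ _ (4 * expR (- 2^-1 * w))); last first.
    by rewrite ler_wpM2r ?expR_ge0// lerDl mulr_ge0// expR_ge0.
  apply: (@le_trans _ _ (4 * expR (w / 4) * expR (- (1 + t) * w))).
    rewrite ler_wpM2r ?expR_ge0//.
    by have := expR_ge1Dx (w / 4); lra.
  rewrite -mulrA ler_wpM2l// -expRD ler_expR.
  nra.
apply: (@le_trans _ _ (`|c| * expR `|c| * expR (- 2^-1 * w))); last first.
  by rewrite ler_wpM2r ?expR_ge0// lerDr.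
rewrite -mulrA; apply: ler_pM; rewrite ?expR_ge0//.
  by rewrite ltr0_norm// lerNl.
rewrite -expRD ler_expR.
nra.
Qed.

Lemma is_derive_integral_expR :
  is_derive (0 : R) 1 (fun t => \int[mu]_(x in D) F t x)
     (\int[mu]_(x in D) (- v x * F 0 x)).
Proof.
have [G [G0 intG Gub]] := dominated_derivative_expR.
have I0 : (`]- 4^-1, 4^-1[%classic : set R) 0.
  by rewrite /= in_itv/= oppr_lt0 invr_gt0 ltr0n.
have intF t : (`]- 4^-1, 4^-1[%classic : set R) t -> mu.-integrable D (EFin \o F t).
  rewrite /= in_itv/= => /andP[t1 t2]; apply: integrable_expR_scale.
  lra.
have dF t x : (`]- 4^-1, 4^-1[%classic : set R) t -> D x -> derivable (F^~ x) t 1.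
  by move=> _ _; have [] := derivative_expR_scale t x.
have d1F t x : partial1of2 F t x = - v x * F t x.
  by rewrite partial1of2E; have [_ ->] := derivative_expR_scale t x.
have Gub' t x : (`]- 4^-1, 4^-1[%classic : set R) t -> D x ->
    `|partial1of2 F t x| <= G x.
  by move=> It Dx; rewrite d1F mulNr normrN; exact: Gub.
apply: DeriveDef.
  exact: (@derivable_under_integral R _ Vm mu F D mD 0 _ _ I0 intF dF G G0
    intG Gub').
rewrite -derive1E.
rewrite (@differentiation_under_integral R _ Vm mu F D mD 0 _ _ I0 intF dF G G0
  intG Gub').
by apply: eq_Rintegral => x _; rewrite -d1F.
Qed.

(* With f = exp (- u): Phi 0 is J f and Psi is the integral of f log f. *)
Let Phi t := \int[mu]_(x in D) F t x.
Let Psi := \int[mu]_(x in D) (- v x * F 0 x).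

Lemma integral_expeR_scale t : -1 < t ->
  (\int[mu]_x expeR (- ((1 + t)%:E * u x)))%E = (Phi t)%:E.
Proof.
move=> t1; have t0 : 0 < 1 + t by rewrite -ltrBlDl sub0r.
have [uNy _ cu _] := uL; have iF := integrable_expR_scale (1 + t) t0.
rewrite (integral_edom u (fun w => expeR (- ((1 + t)%:E * w))%E))//.
  rewrite /Phi /Rintegral fineK; last exact: integrable_fin_num.
  by apply: eq_integral => x _ /=; rewrite /F mulNr.
by rewrite gt0_muley ?lte_fin.
Qed.

Lemma int_flogf_expeR : int_flogf (fun x => expeR (- u x)%E) = Psi%:E.
Proof.
have [uNy _ cu _] := uL; rewrite /int_flogf.
rewrite (integral_edom u
  (fun w => expeR (- w) * lne (expeR (- w)))%E)//; last first.
  by rewrite /= mul0e.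
have [G [G0 intG Gub]] := dominated_derivative_expR.
have iPsi : mu.-integrable D (EFin \o (fun x => - v x * F 0 x)).
  apply: (le_integrable mD _ _ intG).
    apply: measurable_funTS; apply/measurable_EFinP; apply: measurable_funM.
      exact: measurableT_comp.
    by apply: measurableT_comp => //; exact: measurable_funM.
  move=> x Dx /=; rewrite lee_fin mulNr normrN (le_trans (Gub 0 x _ Dx))//.
    by rewrite /= in_itv/= oppr_lt0 invr_gt0 ltr0n.
  exact: ler_norm.
rewrite /Psi /Rintegral fineK; last exact: integrable_fin_num.
apply: eq_integral => x _; rewrite -EFinN.
rewrite -[LHS]/((expR (- v x))%:E * lne (expR (- v x))%:E)%E.
rewrite lne_EFin ?expR_gt0// expRK -EFinM.
by rewrite /F addr0 mulN1r mulrC.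
Qed.

Lemma cvg_deltaJ_quotient : deltaJ_quotient (fun x => expeR (- u x)%E)
    (fun x => expeR (- u x)%E) t @[t --> 0^'+] --> (n.+1%:R * Phi 0 + Psi)%:E.
Proof.
pose H t := (1 + t) ^+ n.+1 * Phi t.
have dH : is_derive (0 : R) 1 H (n.+1%:R * Phi 0 + Psi).
  have dPhi := is_derive_integral_expR.
  have -> : H = (cst 1 + id) ^+ n.+1 * Phi.
    by apply/funext => t; rewrite /H !fctE.
  have dX : is_derive (0 : R) 1 (cst 1 + id) 1.
    by apply: is_derive_eq; rewrite add0r.
  apply: is_derive_eq; rewrite !fctE/= addr0 !expr1n.
  rewrite -[LHS]/(1 * Psi + Phi 0 * (n.+1%:R * 1 * 1)); ring.
have cH : t^-1 * (H t - H 0) @[t --> (0:R)^'+] --> n.+1%:R * Phi 0 + Psi.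
  apply: cvg_dnbhs_at_right.
  have [dH1 <-] := dH.
  rewrite [X in X @ _ --> _](_ : _ =
    fun h : R => h^-1 *: ((H \o shift 0) (h *: 1) - H 0)).
    exact: dH1.
  by apply/funext => h; rewrite /= addr0 [h%:A]mulr1.
apply: cvg_trans; last first.
  have := cvg_EFin (f := fun t => (t^-1 * (H t - H 0))%:E) _ cH. apply.
  exact: nearW.
apply: near_eq_cvg; near=> t.
have t0 : 0 < t by near: t; exact: nbhs_right_gt.
rewrite /deltaJ_quotient J_oplus// integral_expeR_scale ?(lt_trans _ t0)//.
have -> : J (fun x => expeR (- u x)%E) = (Phi 0)%:E.
  rewrite -integral_expeR_scale//.
  by apply: eq_integral => x _; rewrite addr0 mul1e.
by rewrite mulrC /H addr0 expr1n mul1r EFinM EFinB EFinM.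
Unshelve. all: by end_near. Qed.

End derivative.
End variation.

Theorem proposition3p11 (R : realType) (n : nat) (f : 'rV[R]_n.+1 -> \bar R)
    (fA : classA f) (Jf_gt0 : 0 < J f) :
  [/\ entropy f \is a fin_num,
      cvg (deltaJ_quotient f f t @[t --> 0%R^'+]),
      deltaJ f f = n.+1%:R%:E * J f + int_flogf f &
      n.+1%:R%:E * J f + int_flogf f = (n.+1%:R%:E + lne (J f)) * J f + entropy f].
Proof.
case: fA Jf_gt0 => u uL ->{f}.
set f := fun x => _ => Jf_gt0.
have [uNy _ cu _] := uL.
have um := measurable_econvex u uNy cu.
have mD := measurable_edom u um.
(* f vanishes outside the domain of u, so a null domain would give J f = 0. *)
have u0 : @lebesgue_outer R n (edom u) != 0.
  apply/eqP => D0; move: Jf_gt0.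
  rewrite /J (integral_edom u (fun w => expeR (- w)))// null_set_integral ?ltxx//.
  apply: measurable_funTS; apply: measurableT_comp; first exact: measurable_expeR.
  apply: measurableT_comp => //; apply/measurable_EFinP.
  exact: measurableT_comp um.
have cvgf := cvg_deltaJ_quotient u uL u0.
have flogf := int_flogf_expeR u uL u0.
set Phi0 := (\int[_]_(x in _) expR (- (1 + 0) * _))%R in cvgf.
set Psi := (\int[_]_(x in _) _)%R in flogf cvgf.
have JE : J f = Phi0%:E.
  rewrite /Phi0 -(integral_expeR_scale u uL u0) ?ltrN10//.
  by apply: eq_integral => x _; rewrite addr0 mul1e.
have Phi0_gt0 : (0 < Phi0)%R by rewrite -lte_fin -JE.
have entE : entropy f = (Psi - Phi0 * ln Phi0)%:E.
  by rewrite /entropy flogf JE lne_EFin// -EFinM -EFinB.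
split.
- by rewrite entE.
- by apply/cvg_ex; exists (n.+1%:R * Phi0 + Psi)%:E.
- by rewrite /deltaJ (cvg_lim _ cvgf)// flogf JE EFinD EFinM.
- rewrite entE flogf JE lne_EFin// -!EFinM -!EFinD; congr EFin.
  by ring.
Qed.
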